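(* Let $X_1, X_2, \ldots$ be independent non-negative random variables with common continuous distribution function $F$. For each $n \geq 1$ there is a simple adaptive online policy $\widehat{\pi}_n \in \Pi(n)$, namely the policy $\widehat{\pi}_n$ given explicitly in the context (whose decision at each time depends only on the current observation, the value of the last selection and the number of observations yet to be seen), such that $$ (2n)^{1/2} - 2\{\log(n) + 1\} \;\leq\; \mathbb{E}[L_n(\widehat{\pi}_n)] \;\leq\; \mathbb{E}[L_n(\pi^*_n)] \;\leq\; (2n)^{1/2}, $$ where $\pi^*_n \in \Pi(n)$ is the optimal policy, i.e. $\mathbb{E}[L_n(\pi^*_n)] = \sup_{\pi \in \Pi(n)} \mathbb{E}[L_n(\pi)]$.
   Context: Let $\mathcal{F}_0$ be the trivial $\sigma$-field and $\mathcal{F}_i = \sigma\{X_1,\ldots,X_i\}$ for $i \geq 1$. Feasible policies. A feasible policy $\pi \in \Pi(n)$ is a sequence of stopping times $\tau_1, \tau_2, \ldots, \tau_n$ with respect to $(\mathcal{F}_i)$, with values in $\{1,\ldots,n\}\cup\{\infty\}$, such that $\tau_{j} < \tau_{j+1}$ whenever $\tau_j < \infty$, $\tau_{j+1} = \infty$ whenever $\tau_j=\infty$, and $X_{\tau_j} \leq X_{\tau_{j+1}}$ whenever $\tau_{j+1} \leq n$ (the value $\infty$ means that no further selection is made). Thus the selected values form a monotone increasing subsequence $X_{\tau_1} \leq X_{\tau_2} \leq \cdots$, and all selection/rejection decisions are made online and are final. The number of selections made by $\pi$ is $L_n(\pi) = \max\{j : 1 \leq \tau_1 < \cdots < \tau_j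 \leq n\}$ (and $0$ if no selection is made). For each $n\ge 1$ it is known that there is a unique policy $\pi_n^* \in \Pi(n)$ attaining $\sup_{\pi\in\Pi(n)} \mathbb{E}[L_n(\pi)]$. The policy $\widehat{\pi}_n$. For $k \geq 1$ and $s \in [0,1]$ let $$\widehat{h}_k(s) = \min\left\{ s + [2k^{-1}(1-s)]^{1/2},\, 1\right\}.$$ Set $\widehat{\tau}_0 = 0$ and $X_{\widehat{\tau}_0} = 0$, and define recursively, for $1 \leq j \leq n$, $$\widehat{\tau}_j = \min\left\{ \widehat{\tau}_{j-1} < i \leq n : X_i \geq X_{\widehat{\tau}_{j-1}} \text{ and } F(X_i) \leq \widehat{h}_{n-i+1}\big(F(X_{\widehat{\tau}_{j-1}})\big)\right\},$$ with $\widehat{\tau}_j = \infty$ if this set is empty (or if $\widehat{\tau}_{j-1}=\infty$). When the $X_i$ are uniform on $[0,1]$ (so $F(x)=x$ on $[0,1]$), this says that $X_i$ is selected if and only if $X_i \in [s, \widehat{h}_{n-i+1}(s)]$, where $s$ is the value of the last selection ($s=0$ if none has been made). Here $\log$ is the natural logarithm. *)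

(* Defs.v *)
From mathcomp Require Import all_boot all_order all_algebra finmap.
From mathcomp Require Import all_classical all_reals all_analysis.

Set Implicit Arguments.
Unset Strict Implicit.
Unset Printing Implicit Defensive.
Import Order.TTheory GRing.Theory Num.Theory.
Import numFieldNormedType.Exports.
Local Open Scope classical_set_scope.
Local Open Scope ring_scope.

(* Observations X_1, X_2, ... are indexed from 1, so that X 0 is never used.
   A random time is a function T -> option nat, with None standing for
   infinity.  A policy is a sequence of random times tau_1, ..., tau_n, also
   indexed from 1; its values at other indices are irrelevant. *)

Definition mutually_independent d (T : measurableType d) (R : realType)
    (P : probability T R) (D : set nat) (X : nat -> T -> R) : Prop :=
  forall (J : {fset nat}) (B : nat -> set R),
    [set` J] `<=` D -> (forall j, measurable (B j)) ->
    P (\bigcap_(j in [set` J]) (X j @^-1` B j)) =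
    (\prod_(j <- J) P (X j @^-1` B j))%E.

Section Policies.
Context {T : Type} {R : realType}.
Variable X : nat -> T -> R.

(* The sigma-field generated by X_1, ..., X_i; for i = 0 it is generated by
   the empty family, hence trivial. *)
Definition natural_filtration (i : nat) : set (set T) :=
  <<s \bigcup_(k in [set k | (1 <= k <= i)%N])
        preimage_set_system setT (X k) measurable >>.

Definition time_le (t : option nat) (i : nat) : bool :=
  if t is Some k then (k <= i)%N else false.

Definition time_lt (t u : option nat) : bool :=
  match t, u with
  | Some k, Some l => (k < l)%N
  | Some _, None => true
  | None, _ => false
  end.

Definition within_horizon (n : nat) (t : option nat) : bool :=
  if t is Some k then (1 <= k <= n)%N else false.

Definition stopping_time (tau : T -> option nat) : Prop :=
  forall i, natural_filtration i [set w | time_le (tau w) i].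

Definition feasible (n : nat) (tau : nat -> T -> option nat) : Prop :=
  (forall j, (1 <= j <= n)%N ->
     stopping_time (tau j) /\
     forall w, tau j w = None \/ within_horizon n (tau j w)) /\
  (forall j w, (1 <= j < n)%N ->
     [/\ tau j w <> None -> time_lt (tau j w) (tau j.+1 w),
         tau j w = None -> tau j.+1 w = None
       & forall k l, tau j w = Some k -> tau j.+1 w = Some l ->
           X k w <= X l w]).

(* A decision rule acc k s x tells whether to select the current observation x
   when s is the value of the last selection (0 if there is none) and k
   observations are yet to be seen, the current one included. *)
Definition last_value (i : nat) (w : T) : R :=
  if i is 0%N then 0 else X i w.

Fixpoint adaptive_policy (acc : nat -> R -> R -> bool) (n j : nat) (w : T)
    : option nat :=
  if j is j'.+1 then
    if adaptive_policy acc n j' w is Some i0 then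
      ohead [seq i <- index_iota i0.+1 n.+1
               | acc (n - i + 1)%N (last_value i0 w) (X i w)]
    else None
  else Some 0%N.

End Policies.

Definition num_selected (T : Type) (n : nat) (tau : nat -> T -> option nat)
    (w : T) : nat :=
  \max_(1 <= j < n.+1 |
      (let s := [seq tau k w | k <- iota 1 j] in
       sorted time_lt s && all (within_horizon n) s)) j.

Definition hhat (R : realType) (k : nat) (s : R) : R :=
  Num.min (s + Num.sqrt (2 * k%:R^-1 * (1 - s))) 1.

Definition accept_hat (R : realType) (F : R -> R) (k : nat) (s x : R) : bool :=
  (s <= x) && (F x <= hhat k (F s)).

Definition pi_hat (T : Type) (R : realType) (F : R -> R) (X : nat -> T -> R)
    (n : nat) : nat -> T -> option nat :=
  adaptive_policy X (accept_hat F) n.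

Section Performance.
Context d (T : measurableType d) (R : realType) (P : probability T R).

Definition mean_selected (n : nat) (tau : nat -> T -> option nat) : \bar R :=
  expectation P (fun w => (num_selected n tau w)%:R).

Definition optimal_value (X : nat -> T -> R) (n : nat) : \bar R :=
  ereal_sup [set mean_selected n tau | tau in [set tau | feasible X n tau]].

Definition optimal (X : nat -> T -> R) (n : nat)
    (tau : nat -> T -> option nat) : Prop :=
  feasible X n tau /\ mean_selected n tau = optimal_value X n.

End Performance.

(* Main.v *)
Require Import Defs.
From mathcomp Require Import all_boot all_order all_algebra.
From mathcomp Require Import finmap ring lra.
From mathcomp Require Import all_classical all_reals all_analysis.
From mathcomp Require Import measurable_realfun.
Set Implicit Arguments.
Unset Strict Implicit.
Unset Printing Implicit Defensive.
Import Order.TTheory GRing.Theory Num.Theory.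
Import numFieldNormedType.Exports.
Local Open Scope classical_set_scope.
Local Open Scope ring_scope.

(** Everything is measured on the scale U_i = F(X_i), on which the observations
    are independent and uniform on [0, 1].  Let M_i be the level of the last
    selection after time i (0 at the start), and sigma_i the indicator that
    observation i is selected.  Both bounds are pointwise inequalities summed
    over time, after which the expectation of each increment is bounded with
    the past frozen: a statistic of X_1, ..., X_i is independent of X_{i+1}, so
    a bound on the mean of g (s, X_{i+1}) for each value s of the statistic is
    a bound on the mean at the random value ([integral_independent_le],
    [natural_filtration_indep_next]).

    Upper bound.  A feasible policy selects only above M_{i-1}, so for any price
    lam > 0
      lam sigma_i <= (M_i - M_{i-1}) + max (0, lam - (U_i - M_{i-1})),
    the last term being counted only when U_i >= M_{i-1}; its mean is at most
    lam^2 / 2 ([mean_shortfall_le]).  The level never exceeds 1, so summation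
    gives lam E[L_n] <= 1 + n lam^2 / 2, and lam = sqrt (2 / n) yields sqrt (2n).

    Lower bound.  The function v_k(m) = sqrt (2k(1 - m)) - 2 H_k, with H_k the
    k-th harmonic number, is a subsolution of the dynamic programming equation
    of the explicit policy: from level m with k + 1 observations to come, the
    selection count plus the value v_k of the new level has mean at least
    v_{k+1}(m) ([value_bound_drift], [mean_regret_le]).  The correction 2 H_k
    pays for the error, of order 1/k at each step, of the expansion of the
    square root ([drift_bound]).  As v_0 = 0, telescoping over the n steps gives
    E[L_n] >= v_n(0) ([regret_telescope], [mean_pi_hat_ge]), and
    H_n <= log n + 1.

    Means of functions of U_i reduce to integrals of polynomials over windows
    [a, b] of [0, 1] ([integral_cdf_window]), because the square root is compared
    with a quadratic polynomial before integrating ([sqrt_chord]). *)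

(** * A subsolution of the dynamic programming equation *)

Section Numerics.
Context {R : realType}.
Implicit Types a y x t m s q f : R.

(** The left side is (1 - q)(1 + q / 2), and (1 - q)(1 + q / 2)^2 <= 1. *)
Lemma sqrt_1B_ge q : 0 <= q <= 1 -> 1 - q / 2 - q ^+ 2 / 2 <= Num.sqrt (1 - q).
Proof.
move=> /andP[q0 q1].
have -> : 1 - q / 2 - q ^+ 2 / 2 = (1 - q) * (1 + q / 2) by field.
have h0 : 0 <= (1 - q) * (1 + q / 2) by apply: mulr_ge0; lra.
rewrite -[leLHS]ger0_norm // -sqrtr_sqr ler_wsqrtr //.
nra.
Qed.

(** The loss of square root caused by lowering x to x - t is dominated by a
    quadratic polynomial in t valid up to t = x, so that its mean over a uniform
    t needs only the first two moments.  At x = 0 both sides vanish. *)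
Lemma sqrt_chord (c x t : R) : 0 <= c -> 0 <= t <= x ->
  Num.sqrt (c * x) - Num.sqrt (c * (x - t)) <=
  Num.sqrt (c * x) * (t / (2 * x) + t ^+ 2 / (2 * x ^+ 2)).
Proof.
move=> c0 /andP[t0 tx].
have [x0|x0] := eqVneq x 0.
  have -> : t = 0 by apply/eqP; rewrite eq_le t0 andbT -x0.
  by rewrite subr0 subrr !mul0r expr0n /= mul0r addr0 mulr0.
have xp : 0 < x by rewrite lt_neqAle eq_sym x0 (le_trans t0 tx).
have -> : c * (x - t) = (c * x) * (1 - t / x) by field.
rewrite (sqrtrM (1 - t / x)) ?mulr_ge0 ?(ltW xp) //.
have q01 : 0 <= t / x <= 1.
  by rewrite divr_ge0 ?(ltW xp) //= ler_pdivrMr // mul1r.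
have := ler_wpM2l (sqrtr_ge0 (c * x)) (sqrt_1B_ge q01).
have -> : t / (2 * x) + t ^+ 2 / (2 * x ^+ 2) = (t / x) / 2 + (t / x) ^+ 2 / 2.
  by field.
set q := t / x; set r := Num.sqrt (1 - q); set b := Num.sqrt _.
lra.
Qed.

(** The inequality behind the value function, with y = 1/k for k observations
    to come, x = 1 - m the room left, a = sqrt (2kx), f = sqrt (2(k-1)x) and d the
    width of the acceptance window.  If a > 2 the window has width a y < x and the
    terms of order a y cancel, which is what the choice of the window achieves; the
    remainder is controlled by a y <= 1.  If a <= 2 the window is all of
    [m, 1] and every term is already of order y. *)
Lemma drift_bound (a f x y d : R) : 0 <= a -> 0 < y <= 1 -> x <= 1 ->
  x = a ^+ 2 * y / 2 -> d = Num.min (a * y) x ->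
  0 <= f <= a -> a * (1 - y / 2 - y ^+ 2 / 2) <= f ->
  a - f - d + f * (d ^+ 2 / (4 * x) + d ^+ 3 / (6 * x ^+ 2)) <= 2 * y.
Proof.
move=> a0 /andP[y0 y1] x1 xE dE /andP[f0 fa] fl.
have [a_eq0|an0] := eqVneq a 0.
  rewrite a_eq0 in xE dE fa *.
  have -> : f = 0 by apply/eqP; rewrite eq_le f0 fa.
  have -> : d = 0 by rewrite dE xE expr0n /= !mul0r minxx.
  by lra.
have ap : 0 < a by rewrite lt_neqAle eq_sym an0.
have xp : 0 < x by rewrite xE divr_gt0 // mulr_gt0 // exprn_gt0.
have yy : y ^+ 2 <= y by rewrite expr2 ler_piMl // ltW.
have a2 : 0 < a ^+ 2 by rewrite exprn_gt0.
have [a_le2|a_gt2] := leP a 2.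
  have {dE} -> : d = x.
    rewrite dE; apply/min_idPr; rewrite xE expr2; nra.
  have -> : x ^+ 2 / (4 * x) + x ^+ 3 / (6 * x ^+ 2) = x * (5 / 12).
    by field; rewrite gt_eqF.
  have fx : f * (x * (5 / 12)) <= a * (x * (5 / 12)).
    by rewrite ler_wpM2r // mulr_ge0 //; lra.
  have h1 : a - f <= a * y by nra.
  apply: le_trans (_ : a * y - x + a * (x * (5 / 12)) <= _); first lra.
  have -> : a * y - x + a * (x * (5 / 12))
     = y * (a - a ^+ 2 / 2 + 5 / 24 * (a ^+ 2 * a)) by rewrite xE; field.
  rewrite mulrC ler_wpM2r ?(ltW y0) //.
  have : a ^+ 2 * a <= a ^+ 2 * 2 by rewrite ler_wpM2l // ltW.
  lra.
have dE' : d = a * y.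
  rewrite dE; apply/min_idPl; rewrite xE expr2; nra.
have d1 : a * y <= 1.
  by rewrite -dE' dE; apply: le_trans x1; rewrite ge_min lexx orbT.
have -> : d ^+ 2 / (4 * x) + d ^+ 3 / (6 * x ^+ 2) = y / 2 + 2 * y / (3 * a).
  rewrite dE' xE; field; by rewrite !gt_eqF.
have fl2 : f * (y / 2 + 2 * y / (3 * a)) <= a * (y / 2 + 2 * y / (3 * a)).
  rewrite ler_wpM2r // addr_ge0 ?divr_ge0 ?mulr_ge0 //; lra.
apply: le_trans (_ : a * (y / 2 + y ^+ 2 / 2) - a * y
   + a * (y / 2 + 2 * y / (3 * a)) <= _); first by rewrite dE'; lra.
have -> : a * (y / 2 + y ^+ 2 / 2) - a * y + a * (y / 2 + 2 * y / (3 * a))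
  = y * (a * y / 2 + 2 / 3) by field.
rewrite mulrC ler_wpM2r ?(ltW y0) //; lra.
Qed.

Definition harmonic_sum (k : nat) : R := \sum_(i < k) i.+1%:R^-1.

(** Each term 1/(k+1) is at most ln (k+1) - ln k. *)
Lemma harmonic_sum_le_ln (n : nat) : (1 <= n)%N -> harmonic_sum n <= ln n%:R + 1.
Proof.
case: n => // n _; elim: n => [|n ih].
  by rewrite /harmonic_sum big_ord1 invr1 ln1 add0r.
rewrite /harmonic_sum big_ord_recr /= -/(harmonic_sum n.+1).
have n1 : 0 < n.+1%:R :> R by rewrite ltr0n.
have n2 : 0 < n.+2%:R :> R by rewrite ltr0n.
have : ln (n.+1%:R / n.+2%:R) <= n.+1%:R / n.+2%:R - 1 :> R.
  have h : - 1 < n.+1%:R / n.+2%:R - 1 :> R by rewrite ltrBrDr addNr divr_gt0.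
  by have := le_ln1Dx h; rewrite addrC subrK.
rewrite ln_div ?posrE //.
have -> : n.+1%:R / n.+2%:R - 1 = - n.+2%:R^-1 :> R.
  rewrite -[n.+2]addn1 natrD; field.
  by rewrite -natr1 in n2; rewrite gt_eqF // -natr1.
move: (ln _) (ln _) (harmonic_sum _) (_^-1) ih => u v w z. lra.
Qed.

(** A lower bound for the mean number of further selections of the explicit
    policy from level m with k observations to come. *)
Definition value_bound (k : nat) (m : R) : R :=
  Num.sqrt (2 * k%:R * (1 - m)) - 2 * harmonic_sum k.

Lemma value_bound0 m : value_bound 0 m = 0.
Proof.
by rewrite /value_bound /harmonic_sum big_ord0 !mulr0 mul0r sqrtr0 subrr.
Qed.

Lemma harmonic_sumS k : harmonic_sum k.+1 = harmonic_sum k + k.+1%:R^-1.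
Proof. by rewrite /harmonic_sum big_ord_recr. Qed.

Lemma le_value_bound k m u : m <= u -> value_bound k u <= value_bound k m.
Proof.
move=> mu; rewrite /value_bound lerD2r ler_wsqrtr // ler_wpM2l ?mulr_ge0 //.
by rewrite lerD2l lerN2.
Qed.

Lemma value_boundS_ge k m : m <= 1 -> - 2 <= value_bound k.+1 m - value_bound k m.
Proof.
move=> m1; rewrite /value_bound harmonic_sumS.
have : Num.sqrt (2 * k%:R * (1 - m)) <= Num.sqrt (2 * k.+1%:R * (1 - m)).
  by rewrite ler_wsqrtr // ler_wpM2r ?subr_ge0 // ler_wpM2l // ler_nat.
have : k.+1%:R^-1 <= 1 :> R by rewrite invf_le1 ?ltr0n // ler1n.
move: (k.+1%:R^-1) (harmonic_sum k) (Num.sqrt _) (Num.sqrt _) => ? ? ? ? ? ?; lra.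
Qed.

Lemma value_bound_loss k m u : m <= u <= 1 ->
  value_bound k m - value_bound k u <=
  Num.sqrt (2 * k%:R * (1 - m)) *
  ((u - m) / (2 * (1 - m)) + (u - m) ^+ 2 / (2 * (1 - m) ^+ 2)).
Proof.
move=> /andP[mu u1]; rewrite /value_bound.
have c0 : 0 <= 2 * k%:R :> R by rewrite mulr_ge0.
have tx : 0 <= u - m <= 1 - m by lra.
have := sqrt_chord c0 tx.
have -> : 1 - m - (u - m) = 1 - u by ring.
move: (Num.sqrt _) (Num.sqrt _) (harmonic_sum k) (_ / _ + _ / _) => *; lra.
Qed.

(** The subtracted term is the mean of the quadratic bound of
    [value_bound_loss] over a window of width d, that is, its integral with
    (u - m) and (u - m)^2 replaced by d^2 / 2 and d^3 / 3. *)
Lemma value_bound_drift k m (d := hhat k.+1 m - m) : 0 <= m <= 1 ->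
  value_bound k.+1 m - value_bound k m <=
  d - Num.sqrt (2 * k%:R * (1 - m)) *
      (d ^+ 2 / (4 * (1 - m)) + d ^+ 3 / (6 * (1 - m) ^+ 2)).
Proof.
move=> /andP[m0 m1].
set x := 1 - m; set y : R := k.+1%:R^-1.
have kp : 0 < k.+1%:R :> R by rewrite ltr0n.
have y01 : 0 < y <= 1 by rewrite invr_gt0 kp /= invf_le1 // ler1n.
set a := Num.sqrt (2 * k.+1%:R * x).
have x0 : 0 <= x by rewrite subr_ge0.
have xE : x = a ^+ 2 * y / 2.
  rewrite /a sqr_sqrtr ?mulr_ge0 // /y; field; by rewrite addrC natr1 gt_eqF.
have dE : d = Num.min (a * y) x.
  rewrite /d /hhat addr_minl.
  congr (Num.min _ _); first rewrite addrAC subrr add0r.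
  rewrite /a -[y in RHS]ger0_norm; last by case/andP: y01 => /ltW.
  rewrite -sqrtr_sqr -sqrtrM ?mulr_ge0 //; congr Num.sqrt.
  by rewrite /y /x; field; rewrite addrC natr1 gt_eqF.
have yk : 1 - y = k%:R * y.
  by rewrite /y -natr1; field; rewrite natr1 gt_eqF.
set f := Num.sqrt (2 * k%:R * x).
have fE : f = a * Num.sqrt (1 - y).
  rewrite /f /a -sqrtrM ?mulr_ge0 //; congr Num.sqrt.
  by rewrite yk /y; field; rewrite addrC natr1 gt_eqF.
have a0 : 0 <= a by rewrite sqrtr_ge0.
have yI : 0 <= y <= 1 by case/andP: y01 => /ltW -> ->.
have f01 : 0 <= f <= a.
  rewrite sqrtr_ge0 /= ler_wsqrtr // ler_wpM2r // ler_wpM2l // ler_nat //.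
have fl : a * (1 - y / 2 - y ^+ 2 / 2) <= f.
  by rewrite fE ler_wpM2l // sqrt_1B_ge.
have x1 : x <= 1 by rewrite gerBl.
have := drift_bound a0 y01 x1 xE dE f01 fl.
rewrite /value_bound harmonic_sumS -/x -/y -/a -/f.
move: (harmonic_sum k) (_ / _ + _ / _) => *; lra.
Qed.

End Numerics.

(** * Selected observations *)

Section Selections.
Context {T : Type} {R : realType}.
Variable X : nat -> T -> R.

Definition selected (n : nat) (tau : nat -> T -> option nat) (i : nat) (w : T)
    : bool :=
  has (fun j => tau j w == Some i) (iota 1 n).

Lemma selectedP n tau i w :
  reflect (exists2 j, (1 <= j <= n)%N & tau j w = Some i) (selected n tau i w).
Proof.
apply: (iffP hasP) => [[j jn /eqP tji]|[j jn tji]]; exists j => //.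
- by move: jn; rewrite mem_iota add1n ltnS.
- by rewrite mem_iota add1n ltnS.
- by apply/eqP.
Qed.

(** In a feasible policy a finite selection time is preceded by finite, smaller
    ones carrying smaller values; all order properties of selections follow. *)
Lemma feasible_earlier n tau j j' i w : feasible X n tau ->
  (1 <= j)%N -> (j <= j')%N -> (j' <= n)%N -> tau j' w = Some i ->
  exists k, [/\ tau j w = Some k, (k <= i)%N, (j < j')%N -> (k < i)%N
              & X k w <= X i w].
Proof.
move=> [_ ftau] j1; elim: j' i => [|j' ih] i jj' j'n tji.
  by move: (leq_trans j1 jj').
move: jj'; rewrite leq_eqVlt => /orP[/eqP ->|]; first by exists i; rewrite ltnn.
rewrite ltnS => jj'.
have j'n' : (1 <= j' < n)%N by rewrite (leq_trans j1 jj').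
have [lt_tau None_tau le_tau] := ftau j' w j'n'.
case tj' : (tau j' w) => [l|]; last by rewrite None_tau in tji.
have li : (l < i)%N by have := lt_tau; rewrite tj' tji /=; apply.
have [k [tjk kl _ Xkl]] := ih l jj' (ltnW j'n) tj'.
exists k; split => //; first exact: ltnW (leq_ltn_trans kl li).
- by move=> _; exact: leq_ltn_trans li.
- exact: le_trans Xkl (le_tau _ _ tj' tji).
Qed.

Lemma selected_le n tau k i w : feasible X n tau -> (k < i)%N ->
  selected n tau k w -> selected n tau i w -> X k w <= X i w.
Proof.
move=> ft ki /selectedP[j /andP[j1 jn] tjk] /selectedP[j' /andP[j'1 j'n] tj'i].
have [jj'|j'j] := leqP j j'.
  by have [k' [+ _ _ ?]] := feasible_earlier ft j1 jj' j'n tj'i; rewrite tjk => -[->].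
have [i' [+ + _ _]] := feasible_earlier ft j'1 (ltnW j'j) jn tjk.
by rewrite tj'i => -[<-]; rewrite leqNgt ki.
Qed.

Lemma selected_horizon n tau i w : feasible X n tau ->
  selected n tau i w -> (1 <= i <= n)%N.
Proof.
move=> [ft _] /selectedP[j jn tji].
by have [_ /(_ w)] := ft j jn; rewrite tji => -[].
Qed.

Lemma time_lt_trans : transitive time_lt.
Proof. by move=> [k|] [l|] [m|] //=; exact: ltn_trans. Qed.

Lemma time_lt_irr : irreflexive time_lt.
Proof. by case => //= k; exact: ltnn. Qed.

(** Counting selections by time instead of by rank: the selection times are
    distinct, and those of rank at most the number of selections are exactly the
    finite ones. *)
Lemma num_selectedE n tau w : feasible X n tau ->
  num_selected n tau w = (\sum_(i < n) selected n tau i.+1 w)%N.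
Proof.
move=> ft; set sel := [seq i <- iota 1 n | selected n tau i w].
have <- : size sel = (\sum_(i < n) selected n tau i.+1 w)%N.
  rewrite size_filter -sum1_count big_mkcond /= (iotaDl 1 0) big_map.
  by rewrite -(big_mkord xpredT (fun i => selected n tau i.+1 w : nat))
             /index_iota subn0; apply: eq_bigr => i _; case: selected.
have uniq_sel : uniq (map (@Some nat) sel).
  by rewrite map_inj_uniq ?filter_uniq ?iota_uniq // => ? ? [].
apply/eqP; rewrite eqn_leq; apply/andP; split.
  apply/bigmax_leqP_seq => j; rewrite mem_index_iota ltnS => /andP[j1 jn].
  move=> /andP[srt alls].
  (* the first j times are j distinct elements of the set of selected times *)
  rewrite -(size_map (@Some nat)) -[leqLHS](size_iota 1) -(size_map (tau^~ w)).
  apply: uniq_leq_size; first exact: sorted_uniq time_lt_trans time_lt_irr _ srt.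
  move=> t tin; have := allP alls _ tin.
  case: t tin => //= i /mapP[k]; rewrite mem_iota add1n ltnS => /andP[k1 kj] tki.
  move=> iin; apply/mapP; exists i => //.
  rewrite mem_filter mem_iota add1n ltnS iin andbT.
  by apply/selectedP; exists k => //; rewrite k1 (leq_trans kj).
(* conversely each selected time occurs among the first L times *)
set L := num_selected n tau w.
rewrite -[leqRHS](size_iota 1) -[leqRHS](size_map (tau^~ w)).
rewrite -(size_map (@Some nat)).
apply: uniq_leq_size => // t /mapP[i + ->]; rewrite mem_filter => /andP[+ _].
move=> /selectedP[j /andP[j1 jn] tji].
apply/mapP; exists j => //; rewrite mem_iota add1n ltnS j1 /=.
apply: (leq_bigmax_seq j); first by rewrite mem_index_iota j1 ltnS.
apply/andP; split.
  apply/(sortedP None) => k; rewrite size_map size_iota => kj.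
  rewrite !(nth_map 0%N) ?size_iota ?(ltnW kj) // !nth_iota ?(ltnW kj) // !add1n.
  have [l [tkl _ _ _]] := feasible_earlier ft (ltn0Sn _) kj jn tji.
  have [l' [tkl' _ + _]] :=
    feasible_earlier ft (ltn0Sn _) (leqnn k.+2) (leq_trans kj jn) tkl.
  have [m [tkm _ + _]] :=
    feasible_earlier ft (ltn0Sn k) (leqnSn _) (leq_trans kj jn) tkl.
  by rewrite tkm tkl /= => + _; apply.
apply/allP => u /mapP[k]; rewrite mem_iota add1n ltnS => /andP[k1 kj] ->.
have [l [tkl _ _ _]] := feasible_earlier ft k1 kj jn tji.
rewrite tkl; apply: (selected_horizon (w := w) ft); apply/selectedP; exists k => //.
by rewrite k1 (leq_trans kj jn).
Qed.

End Selections.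

Section AdaptivePolicies.
Context {T : Type} {R : realType}.
Variables (X : nat -> T -> R) (acc : nat -> R -> R -> bool) (n : nat).
Implicit Types (i j k l : nat) (w : T).

Let accepts l i w := acc (n - i + 1) (last_value X l w) (X i w).

Lemma ohead_filter_iota (a : pred nat) l m k :
  ohead [seq i <- iota l m | a i] = Some k <->
  [/\ (l <= k < l + m)%N, a k & forall i, (l <= i < k)%N -> ~~ a i].
Proof.
elim: m l => [|m ih] l /=.
  by split=> // -[/andP[+ +]]; rewrite addn0 leqNgt => /negP.
case: ifPn => al /=.
  split=> [[<-]|[/andP[lk _] ak nak]].
    split=> //; first by rewrite leqnn addnS ltnS leq_addr.
    by move=> i /andP[]; rewrite leqNgt => /negP.
  congr Some; apply/eqP; rewrite eqn_leq lk /= leqNgt; apply/negP => klt.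
  by have := nak l; rewrite leqnn klt al => /(_ isT).
rewrite ih addSnnS; split=> -[/andP[lk km] ak nak]; split=> //.
- by rewrite (ltnW lk).
- move=> i /andP[]; rewrite leq_eqVlt => /orP[/eqP <- //|li ik].
  by apply: nak; rewrite li.
- by rewrite km andbT ltn_neqAle lk andbT; apply: contraNneq al => ->.
- by move=> i /andP[li ik]; apply: nak; rewrite (ltnW li).
Qed.

Lemma adaptive_policyS j w k :
  adaptive_policy X acc n j.+1 w = Some k <->
  exists l, [/\ adaptive_policy X acc n j w = Some l, (l < k <= n)%N,
                accepts l k w & forall i, (l < i < k)%N -> ~~ accepts l i w].
Proof.
rewrite /=; case: adaptive_policy => [l|]; last first.
  by split=> // -[l []].
rewrite /index_iota ohead_filter_iota.
have ln m : ((l < m)%N -> (m < l.+1 + (n.+1 - l.+1)) = (m <= n))%N.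
  move=> lm; have [ln|nl] := leqP l.+1 n.+1; first by rewrite subnKC.
  move: (ltnW nl); rewrite -subn_eq0 => /eqP ->; rewrite addn0 ltnNge lm /=.
  by apply/esym/negbTE; rewrite -ltnNge; apply: leq_trans lm; exact: ltnW.
split=> [[/andP[lk]]|[l' [[<-] /andP[lk kn] ak nak]]].
  by rewrite ln // => kn ak nak; exists l; split=> //; rewrite lk.
by split=> //; rewrite lk ln.
Qed.

(** The same decisions run forward in time, remembering the index of the last
    selection (0 before the first one), so that each decision becomes a function
    of the past state and the current observation. *)
Fixpoint last_index i w : nat :=
  if i is i'.+1 then
    if accepts (last_index i' w) i w then i else last_index i' w
  else 0.

Lemma last_index_le i w : (last_index i w <= i)%N.
Proof. by elim: i => //= i ih; case: ifP => // _; exact: leqW. Qed.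

(** The forward run and the recursion over ranks agree: after time i the last
    index is some tau_j, and tau_{j+1} has not occurred yet because nothing has been
    accepted since. *)
Lemma last_index_policy i w : exists j,
  [/\ (j <= i)%N, (i <= n)%N -> adaptive_policy X acc n j w = Some (last_index i w)
    & forall i', (last_index i w < i' <= i)%N -> ~~ accepts (last_index i w) i' w].
Proof.
elim: i => [|i [j [ji tj nacc]]].
  by exists 0%N; split=> //; case.
rewrite /=; case: ifPn => acci.
  exists j.+1; split=> //; last first.
    by move=> i' /andP[lti' lei']; rewrite leqNgt lti' in lei'.
  move=> ltin; apply/adaptive_policyS; exists (last_index i w); split=> //.
  - exact/tj/ltnW.
  - by rewrite ltnS last_index_le.
exists j; split; first exact: leqW.
- by move=> ltin; exact/tj/ltnW.
- move=> i' /andP[li']; rewrite leq_eqVlt => /orP[/eqP -> //|i'i].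
  by apply: nacc; rewrite li' -ltnS.
Qed.

Lemma accepts_selected i w : (i < n)%N -> accepts (last_index i w) i.+1 w ->
  selected n (adaptive_policy X acc n) i.+1 w.
Proof.
move=> ltin acci; have [j [ji tj nacc]] := last_index_policy i w.
apply/selectedP; exists j.+1; first by rewrite /= (leq_ltn_trans ji).
apply/adaptive_policyS; exists (last_index i w); split=> //.
- exact/tj/ltnW.
- by rewrite ltnS last_index_le.
Qed.

End AdaptivePolicies.

(** * Independence of the next observation *)

Section Independence.
Context d (T : measurableType d) (R : realType) (P : probability T R).

(** By Tonelli: the joint law of independent S and Y is a product measure, and
    the inner integral is bounded for each value taken by S. *)
Lemma integral_independent_le d1 d2 (T1 : measurableType d1)
    (T2 : measurableType d2) (S : {RV P >-> T1}) (Y : {RV P >-> T2})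
    (g : T1 * T2 -> \bar R) (c : R) :
  (forall A B, measurable A -> measurable B ->
     P (S @^-1` A `&` Y @^-1` B) = P (S @^-1` A) * P (Y @^-1` B))%E ->
  measurable_fun setT g -> (forall z, 0 <= g z)%E ->
  (forall w, \int[P]_v g (S w, Y v) <= c%:E)%E ->
  (\int[P]_w g (S w, Y w) <= c%:E)%E.
Proof.
move=> SY mg g0 gc.
have mSY : measurable_fun setT (fun w => (S w, Y w)).
  by apply: measurable_fun_pair.
pose SYm : {mfun T >-> (T1 * T2)%type} := mfun_Sub (mem_set mSY).
have lawE (A : set (T1 * T2)) : measurable A ->
    (distribution P S \x distribution P Y)%E A = distribution P SYm A.
  by move: A; apply: product_measure_unique => A B mA mB; exact: SY.
have <- : (\int[distribution P SYm]_z g z = \int[P]_w g (S w, Y w))%E.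
  by rewrite ge0_integral_distribution.
rewrite (eq_measure_integral (distribution P S \x distribution P Y)%E); last first.
  by move=> A mA _; rewrite /= lawE.
rewrite fubini_tonelli1 // ge0_integral_distribution //; last 2 first.
- exact: measurable_fun_fubini_tonelli_F.
- by move=> s; apply: integral_ge0.
apply: le_trans (_ : \int[P]_w cst c%:E w <= _)%E; last first.
  by rewrite integral_cst //= probability_setT mule1.
have Fle w : (fubini_F (distribution P Y) g (S w) <= c%:E)%E.
  rewrite /fubini_F ge0_integral_distribution ?gc //.
  exact: measurableT_comp.
apply: ge0_le_integral => //.
- by move=> w _; apply: integral_ge0.
- apply: (measurableT_comp _ (measurable_funPT S)).
  exact: measurable_fun_fubini_tonelli_F.
- by move=> w _; exact: Fle.
Qed.

End Independence.

Section Filtration.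
Context d (T : measurableType d) (R : realType) (P : probability T R).
Variable X : nat -> {RV P >-> R}.
Hypothesis X_indep : mutually_independent P [set i | (1 <= i)%N] (fun i => X i).
Local Notation Fil := (natural_filtration (fun i => X i : T -> R)).

Lemma natural_filtration_measurable i A : Fil i A -> measurable A.
Proof.
apply: smallest_sub; first exact: sigma_algebra_measurable.
by move=> _ [k _ [B mB <-]]; rewrite setTI; exact: measurable_funPTI.
Qed.

(** For fixed B, both sides are finite measures in A; they agree on the
    intersections of preimages under X_1, ..., X_i, which form a generating
    pi-system. *)
Lemma natural_filtration_indep_next i A B : Fil i A -> measurable B ->
  (P (A `&` X i.+1 @^-1` B) = P A * P (X i.+1 @^-1` B))%E.
Proof.
move=> FA mB.
set E := X i.+1 @^-1` B.
have mE : measurable E by exact: measurable_funPTI.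
have PE0 : 0 <= fine (P E) by rewrite fine_ge0.
pose m1 := mrestr P mE.
pose m2 := mscale (NngNum PE0) P.
pose G := [set C | exists2 D : nat -> set R, (forall k, measurable (D k))
  & C = \bigcap_(k in [set` [fset k in iota 1 i]%fset]) (X k @^-1` D k)].
have mG C : G C -> measurable C.
  move=> [D mD ->]; apply: fin_bigcap_measurable => // k _.
  exact: measurable_funPTI.
have GT : G setT.
  by exists (fun=> setT) => //; apply/seteqP; split=> // w _ k _.
have : <<s G >> A.
  move: FA; apply: smallest_sub; first exact: smallest_sigma_algebra.
  move=> _ [k /= ki [C mC <-]]; apply: sub_sigma_algebra.
  exists (fun j => if j == k then C else setT).
    by move=> j; case: ifP.
  rewrite setTI; apply/seteqP; split=> w /=.
    by move=> XC j _ /=; case: ifP => // /eqP ->.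
  by move=> /(_ k); rewrite /= eqxx; apply; rewrite !inE mem_iota add1n ltnS.
have PEf : P E = (fine (P E))%:E by rewrite fineK // fin_num_measure.
have m12 : m1 A = m2 A -> P (A `&` E) = (P A * P E)%E.
  by move=> e; rewrite [in RHS]PEf muleC; exact: e.
move=> sGA; apply: m12; move: A sGA {FA}.
apply: (g_sigma_algebra_measure_unique G mG (fun=> setT)) => //.
- by apply/seteqP; split=> // w _; exists 0%N.
- move=> _ _ [D1 mD1 ->] [D2 mD2 ->]; exists (fun k => D1 k `&` D2 k).
    by move=> k; exact: measurableI.
  by rewrite -bigcapI; apply: eq_bigcapr => k _; rewrite preimage_setI.
- move=> _ [D mD ->].
  set C := \bigcap_(k in _) _.
  transitivity (P E * P C)%E; last by rewrite [in LHS]PEf.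
  rewrite /m1 /= /mrestr /C.
  (* independence is used for the family D extended by B at time i + 1 *)
  pose D' j := if j == i.+1 then B else D j.
  have mD' j : measurable (D' j) by rewrite /D'; case: ifP.
  have notin : i.+1 \notin [fset k in iota 1 i]%fset.
    by rewrite !inE mem_iota add1n ltnn andbF.
  have D'D j : j \in [fset k in iota 1 i]%fset -> D' j = D j.
    by move=> ji; rewrite /D'; case: eqP => // ji'; move: notin; rewrite -ji' ji.
  have D'B : D' i.+1 = B by rewrite /D' eqxx.
  have D'E : \bigcap_(j in [set` [fset k in iota 1 i]%fset]) (X j @^-1` D' j)
           = \bigcap_(j in [set` [fset k in iota 1 i]%fset]) (X j @^-1` D j).
    by apply: eq_bigcapr => j /= ji; rewrite D'D.
  have e1 : [set` [fset k in iota 1 i]%fset] `<=` [set j | (1 <= j)%N].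
    by move=> j /=; rewrite !inE mem_iota => /andP[].
  have e2 : [set` (i.+1 |` [fset k in iota 1 i])%fset] `<=` [set j | (1 <= j)%N].
    by move=> j /=; rewrite !inE mem_iota => /orP[/eqP ->|/andP[]].
  have := X_indep e2 mD'; rewrite big_fsetU1 //= D'B.
  have := X_indep e1 mD'; rewrite D'E => <- <-.
  congr (P _); rewrite -D'E -/E setIC.
  apply/seteqP; split=> w /=.
    move=> [Ew XD] j /=; rewrite in_fset1U => /orP[/eqP ->|ji]; last exact: XD.
    by rewrite D'B.
  move=> XD'; split=> [|j ji].
    by have := XD' i.+1; rewrite /= D'B; apply; rewrite in_fset1U eqxx.
  by apply: XD'; rewrite /= in_fset1U [X in _ || X]ji orbT.
- by move=> _; rewrite /m1 /= /mrestr setTI ltey_eq fin_num_measure.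
Qed.

End Filtration.

(** * The probability integral transform *)

Section ProbabilityIntegralTransform.
Context d (T : measurableType d) (R : realType) (P : probability T R).
Variables (Y : {RV P >-> R}) (F : R -> R).
Hypothesis Y_cdf : forall x, cdf Y x = (F x)%:E.
Hypothesis F_cont : continuous F.

Lemma cdf_fin_bounds x : 0 <= F x <= 1.
Proof. by rewrite -!lee_fin -Y_cdf cdf_ge0 cdf_le1. Qed.

Lemma cdf_fin_le : {homo F : x y / x <= y}.
Proof. by move=> x y xy; rewrite -lee_fin -!Y_cdf cdf_nondecreasing. Qed.

(** Intermediate values, since F tends to 0 and 1 at the two ends. *)
Lemma cdf_fin_onto u : 0 < u < 1 -> exists x, F x = u.
Proof.
move=> /andP[u0 u1].
have FE : fine \o cdf Y = F by apply/funext => x; rewrite /= Y_cdf.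
have [a ua] : exists a, F a < u.
  apply: (@filter_ex _ (-oo : set_system R) _ (fun a => F a < u)).
  have F0 : F @ -oo --> (0 : R) by rewrite -FE; exact/fine_cvg/cvg_cdfNy0.
  exact: (cvgr_lt _ F0 _ u0).
have [b ub] : exists b, u < F b.
  apply: (@filter_ex _ (+oo : set_system R) _ (fun b => u < F b)).
  have F1 : F @ +oo --> (1 : R) by rewrite -FE; exact/fine_cvg/cvg_cdfy1.
  exact: (cvgr_gt _ F1 _ u1).
have ab : a <= b.
  by rewrite leNgt; apply/negP => /ltW /cdf_fin_le; rewrite leNgt (lt_trans ua).
have Fab : F a <= F b by exact: cdf_fin_le.
have [|x _ xu] := @IVT R F a b u ab (continuous_subspaceT F_cont).
  by rewrite (min_idPl Fab) (max_idPr Fab) (ltW ua) (ltW ub).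
by exists x.
Qed.

Lemma measurable_cdf_fin : measurable_fun [set: R] F.
Proof. exact: continuous_measurable_fun. Qed.

Lemma measurable_cdf_transform :
  @measurable_fun _ _ T (measurableTypeR R) [set: T] (F \o Y).
Proof. exact: (measurableT_comp measurable_cdf_fin (measurable_funPT Y)). Qed.

(** The target is the type carrying Lebesgue measure, on which the uniform
    probability is defined; its Borel sets are those of R. *)
Definition cdf_transform : {RV P >-> measurableTypeR R} :=
  @mfun_Sub _ _ T (measurableTypeR R) _ (mem_set measurable_cdf_transform).

(** F need not be injective, so the event F(Y) < u is squeezed: it is contained
    in Y <= x when F x = u, and contains Y <= x when F x < u. *)
Lemma cdf_transform_lt (u : R) :
  P [set w | F (Y w) < u] = (Num.max 0 (Num.min u 1))%:E.
Proof.
have [u0|u0] := leP u 0.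
  rewrite (_ : [set _ | _] = set0) ?measure0.
    by rewrite max_l // ge_min u0.
  apply/seteqP; split=> // w /= Fu.
  have /andP[F0 _] := cdf_fin_bounds (Y w).
  by have := lt_le_trans Fu u0; rewrite ltNge F0.
have mlt : measurable [set w | F (Y w) < u].
  rewrite (_ : [set _ | _] = cdf_transform @^-1` `]-oo, u[%classic).
    exact: measurable_funPTI.
  by apply/seteqP; split=> w; rewrite /= in_itv.
rewrite max_r; last by rewrite le_min (ltW u0) ler01.
apply/eqP; rewrite eq_le; apply/andP; split.
  rewrite /Num.min; case: ifPn => u1; last exact: probability_le1.
  have [x xu] := cdf_fin_onto (introT andP (conj u0 u1)).
  rewrite -xu -Y_cdf.
  change (P [set w | (F (Y w) < F x)%R] <= P (Y @^-1` `]-oo, x]))%E.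
  apply: le_measure; rewrite ?inE //; first by rewrite xu.
    exact: measurable_funPTI.
  move=> w /=; rewrite in_itv /= xu => Fu; rewrite leNgt; apply/negP => /ltW xY.
  by have := cdf_fin_le xY; rewrite xu leNgt Fu.
have m0 : 0 < Num.min u 1 by rewrite lt_min u0 ltr01.
apply/lee_addgt0Pr => e e0.
set u' := Num.min u 1 - e.
have [u'0|u'0] := leP u' 0.
  apply: (@le_trans _ _ e%:E); first by rewrite lee_fin -subr_le0.
  by rewrite leeDr.
have u'1 : u' < Num.min u 1 by rewrite ltrBlDr ltrDl.
have [x xu] : exists x, F x = u'.
  by apply: cdf_fin_onto; rewrite u'0 (lt_le_trans u'1) // ge_min lexx orbT.
rewrite -leeBlDr // -EFinB -/u' -xu -Y_cdf.
change (P (Y @^-1` `]-oo, x]) <= P [set w | (F (Y w) < u)%R])%E.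
apply: le_measure; rewrite ?inE //; first exact: measurable_funPTI.
move=> w /=; rewrite in_itv /= => /cdf_fin_le; rewrite xu => /le_lt_trans; apply.
by rewrite (lt_le_trans u'1) // ge_min lexx.
Qed.

Lemma uniform_prob_lt (u : R) :
  uniform_prob (@ltr01 R) `]-oo, u[%classic = (Num.max 0 (Num.min u 1))%:E.
Proof.
have -> : uniform_prob (@ltr01 R) `]-oo, u[%classic
    = lebesgue_measure (`]-oo, u[%classic `&` `[(0:R), 1]%classic).
  have := @integral_uniform R 0 1 (@ltr01 R) (fun x => (\1_(`]-oo, u[%classic) x)%:E).
  rewrite !integral_indic // setIT subr0 invr1 mul1e => -> //.
  exact/measurable_EFinP/measurable_indic.
have [u0|u0] := leP u 0.
  rewrite max_l; last by rewrite ge_min u0.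
  rewrite (_ : _ `&` _ = set0) ?measure0 //; apply/seteqP; split=> // x [].
  rewrite /= !in_itv /= => xu /andP[x0 _].
  by have := lt_le_trans xu u0; rewrite ltNge x0.
rewrite max_r; last by rewrite le_min (ltW u0) ler01.
have [u1|u1] := leP u 1.
  rewrite (_ : _ `&` _ = `[0, u[%classic); last first.
    apply/seteqP; split=> x; rewrite /= !in_itv /=.
      by move=> [-> /andP[->]].
    by move=> /andP[-> xu]; rewrite xu (ltW (lt_le_trans xu u1)).
  by rewrite lebesgue_measure_itv /= lte_fin u0 sube0.
rewrite (_ : _ `&` _ = `[0, 1]%classic); last first.
  apply/seteqP; split=> x; rewrite /= !in_itv /=; first by case.
  by move=> /andP[-> x1]; rewrite x1 (le_lt_trans x1 u1).
by rewrite lebesgue_measure_itv /= lte_fin ltr01 sube0.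
Qed.

(** The open lower half-lines form a generating pi-system. *)
Lemma cdf_transform_uniform A : measurable A ->
  distribution P cdf_transform A = uniform_prob (@ltr01 R) A.
Proof.
pose m1 : {measure set (measurableTypeR R) -> \bar R} := distribution P cdf_transform.
pose m2 : {measure set (measurableTypeR R) -> \bar R} := uniform_prob (@ltr01 R).
apply: (@measure_unique _ R (measurableTypeR R) (@RGenInftyO.G R) (fun n => `]-oo, n%:R[%classic) _ _ _ _ m1 m2).
- exact: RGenInftyO.measurableE.
- move=> _ _ [x ->] [y ->]; exists (Num.min x y).
  by apply/seteqP; split=> z; rewrite /= !in_itv /= lt_min => /andP.
- by move=> n; exists n%:R.
- apply/seteqP; split=> // x _; exists (Num.truncn x).+1 => //=.
  by rewrite in_itv /= truncnS_gt.
- move=> _ [x ->].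
  transitivity (Num.max 0 (Num.min x 1))%:E; last by rewrite -uniform_prob_lt.
  rewrite -cdf_transform_lt.
  by congr (P _); apply/seteqP; split=> w; rewrite /= in_itv.
- by move=> n; rewrite (le_lt_trans (probability_le1 _ _)) ?ltry.
Qed.

(** Integrating a polynomial derivative over a window of the uniform variable
    F(Y).  The case a = b says that F(Y) has no atoms. *)
Lemma integral_cdf_window (p : {poly R}) (a b : R) :
  0 <= a -> a <= b -> b <= 1 -> (forall u, a <= u <= b -> 0 <= p^`().[u]) ->
  (\int[P]_w ((a <= F (Y w) <= b)%R%:R * p^`().[F (Y w)])%R%:E = (p.[b] - p.[a])%:E)%E.
Proof.
move=> a0 ab b1 p0.
pose h u := (((a <= u <= b)%R%:R * p^`().[u])%:E : \bar R).
have h0 u : (0 <= h u)%E.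
  rewrite /h lee_fin; have [/p0|_] := boolP (a <= u <= b); last by rewrite mul0r.
  by rewrite mul1r.
have hE : h = (fun u => (\1_(`[a, b]%classic) u * p^`().[u])%:E).
  by apply/funext => u; rewrite /h indicE mem_setE /= in_itv.
have mh : measurable_fun setT h.
  rewrite hE; apply/measurable_EFinP/measurable_funM => //.
  apply: continuous_measurable_fun; exact: continuous_horner.
transitivity (\int[distribution P cdf_transform]_u h u)%E.
  by rewrite ge0_integral_distribution.
rewrite (eq_measure_integral (uniform_prob (@ltr01 R))); last first.
  by move=> A mA _; exact: cdf_transform_uniform.
rewrite integral_uniform // subr0 invr1 mul1e.
transitivity (\int[lebesgue_measure]_(x in `[a, b]) (p^`().[x])%:E)%E.
  rewrite [RHS]integral_mkcond [LHS]integral_mkcond; apply: eq_integral => x _.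
  rewrite !patchE !mem_setE /= !in_itv /= /h.
  case: ifPn => x01; case: ifPn => xab; rewrite ?mul1r ?mul0r //.
  case/negP: x01; case/andP: xab => ax xb.
  by rewrite (le_trans a0 ax) (le_trans xb b1).
have [->|anb] := eqVneq a b.
  by rewrite set_itv1 integral_set1 subrr.
have {}ab : a < b by rewrite lt_neqAle anb.
rewrite (continuous_FTC2 (F := horner p)) //.
- exact/continuous_subspaceT/continuous_horner.
- split.
  + by move=> x _; exact: derivable_horner.
  + exact/cvg_at_right_filter/continuous_horner.
  + exact/cvg_at_left_filter/continuous_horner.
- by move=> x _; rewrite derivE.
Qed.

End ProbabilityIntegralTransform.

(** * One-step mean bounds *)

Section OneStep.
Context d (T : measurableType d) (R : realType) (P : probability T R).
Variables (Y : {RV P >-> R}) (F : R -> R).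
Hypothesis Y_cdf : forall x, cdf Y x = (F x)%:E.
Hypothesis F_cont : continuous F.

(** How far the rise from level m to u falls short of the price lam, on the
    observations that a policy at level m may select. *)
Definition shortfall (lam m u : R) : R :=
  if m <= u then Num.max 0 (lam - (u - m)) else 0.

Lemma shortfall_ge0 lam m u : 0 <= shortfall lam m u.
Proof. by rewrite /shortfall; case: ifP => //; rewrite le_max lexx. Qed.

(** The integral of lam - (u - m) over u in [m, m + lam] is lam^2 / 2, and
    cutting the window at 1 only decreases it. *)
Lemma mean_shortfall_le lam m : 0 <= lam -> 0 <= m <= 1 ->
  (\int[P]_w (shortfall lam m (F (Y w)))%:E <= (lam ^+ 2 / 2)%:E)%E.
Proof.
move=> lam0 /andP[m0 m1].
set b := Num.min (m + lam) 1.
have mb : m <= b by rewrite le_min m1 lerDl lam0.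
have b1 : b <= 1 by rewrite ge_min lexx orbT.
pose p : {poly R} := - 2^-1 *: ((lam + m)%:P - 'X) ^+ 2.
have dp u : p^`().[u] = lam - (u - m).
  rewrite /p derivZ deriv_exp derivB derivC derivX !hornerE /=.
  by field.
have dp0 u : m <= u <= b -> 0 <= p^`().[u].
  by rewrite dp le_min => /and3P[_ ulm _]; lra.
rewrite (_ : (fun w => _) = fun w =>
    ((m <= F (Y w) <= b)%R%:R * p^`().[F (Y w)])%R%:E); last first.
  apply/funext => w; congr EFin; rewrite dp /shortfall.
  have /andP[_ Fw1] := cdf_fin_bounds Y_cdf (Y w).
  have [mF|mF] := leP m (F (Y w)); last by rewrite mul0r.
  rewrite /b le_min Fw1 andbT /=.
  have [Flm|Flm] := leP (F (Y w)) (m + lam).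
    by rewrite mul1r max_r //; lra.
  by rewrite mul0r max_l //; lra.
rewrite (integral_cdf_window Y_cdf F_cont m0 mb b1 dp0) lee_fin /p.
rewrite !hornerE /=; have := sqr_ge0 (lam + m - b); nra.
Qed.

(** The predicted value before a step minus the selection count and predicted
    value after it.  The constant 3 makes it nonnegative, so that it can be
    integrated without integrability conditions. *)
Definition regret (k : nat) (s x : R) : R :=
  3 + value_bound k.+1 (F s) -
    (if accept_hat F k.+1 s x then 1 + value_bound k (F x)
     else value_bound k (F s)).

Lemma regret_ge0 k s x : 0 <= regret k s x.
Proof.
have /andP[_ Fs1] := cdf_fin_bounds Y_cdf s.
have := @value_boundS_ge R k (F s) Fs1; rewrite /regret.
case: ifPn => [/andP[sx _]|_]; last by lra.
have := le_value_bound k (cdf_fin_le Y_cdf sx); lra.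
Qed.

Lemma measurable_accept_hat k :
  measurable_fun [set: R * R] (fun z : R * R => accept_hat F k z.1 z.2).
Proof.
have mF := measurable_cdf_fin F_cont.
apply: measurable_and.
  exact: measurable_fun_ler.
apply: measurable_fun_ler; first exact: measurableT_comp.
apply: (measurableT_comp (f := hhat k)); last exact: measurableT_comp.
rewrite /hhat; apply: measurable_minr => //; apply: measurable_funD => //.
apply: nonincreasing_measurable => // x y xy.
by rewrite ler_wsqrtr // ler_wpM2l ?mulr_ge0 ?invr_ge0 // lerD2l lerN2.
Qed.

Lemma measurable_regret k :
  measurable_fun [set: R * R] (fun z : R * R => (regret k z.1 z.2)%:E).
Proof.
have mF := measurable_cdf_fin F_cont.
have mV j : measurable_fun setT (@value_bound R j).
  apply: nonincreasing_measurable => // x y xy; exact: le_value_bound.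
apply/measurable_EFinP; apply: measurable_funB.
  apply: measurable_funD => //; do 2 apply: measurableT_comp => //.
apply: measurable_fun_ifT; first exact: measurable_accept_hat.
  apply: measurable_funD => //; do 2 apply: measurableT_comp => //.
do 2 apply: measurableT_comp => //.
Qed.

(** The acceptance event contains the window m <= F(Y) <= h up to the null event
    F(Y) = m: a value Y < s with F(Y) >= F(s) lies on a flat piece of F.  Hence
    the regret is bounded by quantities that depend on F(Y) alone. *)
Lemma mean_regret_le k s : (\int[P]_w (regret k s (Y w))%:E <= 3%:E)%E.
Proof.
set m := F s; set h := hhat k.+1 m.
have m01 : 0 <= m <= 1 by exact: cdf_fin_bounds.
have /andP[m0 m1] := m01.
have mh : m <= h by rewrite le_min m1 lerDl sqrtr_ge0.
have h1 : h <= 1 by rewrite ge_min lexx orbT.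
set f := Num.sqrt (2 * k%:R * (1 - m)).
have f0 : 0 <= f by exact: sqrtr_ge0.
pose p : {poly R} := (f / (4 * (1 - m))) *: ('X - m%:P) ^+ 2 +
                     (f / (6 * (1 - m) ^+ 2)) *: ('X - m%:P) ^+ 3.
have pE u : p.[u] = f * ((u - m) ^+ 2 / (4 * (1 - m)) +
                         (u - m) ^+ 3 / (6 * (1 - m) ^+ 2)).
  by rewrite /p hornerD !hornerZ !horner_exp hornerXsubC; ring.
have dp u : p^`().[u] =
    f * ((u - m) / (2 * (1 - m)) + (u - m) ^+ 2 / (2 * (1 - m) ^+ 2)).
  rewrite /p derivD !derivZ !deriv_exp derivB derivC derivX !hornerE /=.
  by rewrite !invfM; set r := (1 - m)^-1; field.
have dp0 u : m <= u <= h -> 0 <= p^`().[u].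
  move=> /andP[mu _]; rewrite dp mulr_ge0 // addr_ge0 // divr_ge0 ?mulr_ge0 ?exprn_ge0 ?subr_ge0 //.
pose W w := ((m <= F (Y w) <= h)%R%:R : R).
pose Z w := ((m <= F (Y w) <= m)%R%:R : R).
pose c := 3 + (value_bound k.+1 m - value_bound k m).
have c0 : 0 <= c by have := @value_boundS_ge R k m m1; rewrite /c; lra.
(* Z is the null event F(Y) = m, which contains the rejected part of W *)
have pointwise w : regret k s (Y w) + W w <= c + W w * p^`().[F (Y w)] + Z w.
  have Z0 : 0 <= Z w by exact: ler0n.
  have /andP[_ Fw1] := cdf_fin_bounds Y_cdf (Y w).
  rewrite /regret /accept_hat /W -/m -/h /c.
  have [sY|Ys] := leP s (Y w); last first.
    rewrite /=; have [/andP[mF Fh]|_] := boolP (m <= F (Y w) <= h); last first.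
      by rewrite mul0r /= mulr0n; lra.
    have -> : Z w = 1.
      by rewrite /Z mF (cdf_fin_le Y_cdf (ltW Ys)).
    by have := dp0 (F (Y w)); rewrite mF Fh mulr1n => /(_ isT); lra.
  have mF : m <= F (Y w) by exact: (cdf_fin_le Y_cdf sY).
  rewrite mF /=; case: ifP => [Fh|_] /=; last by rewrite mul0r mulr0n; lra.
  have := @value_bound_loss R k m (F (Y w)); rewrite mF Fw1 -/f -dp mulr1n => /(_ isT).
  lra.
have mFY : measurable_fun setT (F \o Y).
  exact: (measurableT_comp (measurable_cdf_fin F_cont)).
have mwin a b : measurable_fun setT (fun w => ((a <= F (Y w) <= b)%R%:R : R)).
  rewrite (_ : (fun w => _) = \1_(`[a, b]%classic) \o (F \o Y)).
    exact: measurableT_comp.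
  by apply/funext => w; rewrite /= indicE mem_setE /= in_itv.
have mp : measurable_fun setT (fun w => p^`().[F (Y w)]).
  apply: (measurableT_comp (f := horner p^`())) => //.
  apply: continuous_measurable_fun; exact: continuous_horner.
have mreg : measurable_fun setT (fun w => regret k s (Y w)).
  have /measurable_EFinP mr := measurable_regret k.
  apply: (measurableT_comp mr (g := fun w => (s, Y w))).
  exact: measurable_fun_pair.
have EW : (\int[P]_w (W w)%:E = (h - m)%:E)%E.
  have := @integral_cdf_window _ _ _ P Y F Y_cdf F_cont 'X m h m0 mh h1.
  rewrite derivX !hornerE => <-; last by move=> u _; rewrite hornerE.
  by apply: eq_integral => w _; rewrite hornerE mulr1.
have EZ : (\int[P]_w (Z w)%:E = 0%:E)%E.
  have := @integral_cdf_window _ _ _ P Y F Y_cdf F_cont 'X m m m0 (lexx m) m1.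
  rewrite derivX subrr => <-; last by move=> u _; rewrite hornerE.
  by apply: eq_integral => w _; rewrite hornerE mulr1.
have Ep := integral_cdf_window Y_cdf F_cont m0 mh h1 dp0.
have Wp0 w : (0 <= (W w * p^`().[F (Y w)])%:E)%E.
  rewrite lee_fin /W; have [/dp0|_] := boolP (m <= F (Y w) <= h).
    by rewrite mul1r.
  by rewrite mul0r.
have mER : measurable_fun setT (fun w => (regret k s (Y w))%:E).
  exact/measurable_EFinP.
have mEW : measurable_fun setT (fun w => (W w)%:E).
  by apply/measurable_EFinP; exact: mwin.
have mEZ : measurable_fun setT (fun w => (Z w)%:E).
  by apply/measurable_EFinP; exact: mwin.
have mEp : measurable_fun setT (fun w => (W w * p^`().[F (Y w)])%:E).
  by apply/measurable_EFinP; apply: measurable_funM => //; exact: mwin.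
have R0 w : (0 <= (regret k s (Y w))%:E)%E by rewrite lee_fin regret_ge0.
have W0 w : (0 <= (W w)%:E)%E by rewrite lee_fin; exact: ler0n.
have Z0 w : (0 <= (Z w)%:E)%E by rewrite lee_fin; exact: ler0n.
have : (\int[P]_w ((regret k s (Y w))%:E + (W w)%:E) <=
   \int[P]_w (cst c%:E w + (W w * p^`().[F (Y w)])%:E + (Z w)%:E))%E.
  apply: ge0_le_integral => //.
  - by move=> w _; rewrite adde_ge0.
  - exact: emeasurable_funD.
  - by apply: emeasurable_funD => //; exact: emeasurable_funD.
  - by move=> w _; rewrite -!EFinD lee_fin pointwise.
rewrite ge0_integralD // ge0_integralD //; last 2 first.
- by move=> w _; rewrite adde_ge0.
- exact: emeasurable_funD.
rewrite ge0_integralD // integral_cst //= probability_setT mule1 EW EZ Ep adde0.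
rewrite -EFinD => le1.
suff: (\int[P]_w (regret k s (Y w))%:E + (h - m)%:E <= 3%:E + (h - m)%:E)%E.
  by rewrite leeD2rE.
apply: (le_trans le1); rewrite -EFinD lee_fin.
have := value_bound_drift k m01; rewrite -/h -/f !pE subrr /c.
by rewrite !expr0n /= !mul0r addr0 mulr0; lra.
Qed.

End OneStep.

(** * Adaptedness and feasibility *)

Section FiltrationSets.
Context d (T : measurableType d) (R : realType).
Variable X : nat -> T -> R.
Local Notation Fil := (natural_filtration X).
Local Notation gens i := (\bigcup_(k in [set k | (1 <= k <= i)%N])
  preimage_set_system setT (X k) (@measurable _ R)).
Local Notation FilType i := (g_sigma_algebraType (gens i)).

Lemma natural_filtration_le i j A : (i <= j)%N -> Fil i A -> Fil j A.
Proof.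
move=> ij; apply: smallest_sub; first exact: smallest_sigma_algebra.
move=> B [k /= /andP[k1 ki] XB]; apply: sub_sigma_algebra; exists k => //=.
by rewrite k1 (leq_trans ki).
Qed.

Lemma fil_prop i (Q : Prop) : Fil i [set _ | Q].
Proof.
have [q|nq] := pselect Q.
  rewrite (_ : [set _ | Q] = setT); last by apply/seteqP; split.
  exact: (@measurableT _ (FilType i)).
rewrite (_ : [set _ | Q] = set0); last by apply/seteqP; split.
exact: (@measurable0 _ (FilType i)).
Qed.

Lemma fil_and i A B : Fil i A -> Fil i B -> Fil i [set w | A w /\ B w].
Proof. exact: (@measurableI _ (FilType i)). Qed.

Lemma fil_not i A : Fil i A -> Fil i [set w | ~ A w].
Proof. exact: (@measurableC _ (FilType i)). Qed.

Lemma fil_exists i (A : nat -> set T) :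
  (forall l, Fil i (A l)) -> Fil i [set w | exists l, A l w].
Proof.
move=> FA; rewrite (_ : [set _ | _] = \bigcup_l A l).
  by apply: (@bigcupT_measurable _ (FilType i)).
by apply/seteqP; split=> w /= [l] => [|_] Al; exists l.
Qed.

Lemma fil_forall i (A : nat -> set T) :
  (forall l, Fil i (A l)) -> Fil i [set w | forall l, A l w].
Proof.
move=> FA; rewrite (_ : [set _ | _] = \bigcap_l A l).
  by apply: (@bigcapT_measurable _ (FilType i)).
by apply/seteqP; split=> w /= Aw l => [_|]; exact: Aw.
Qed.

Lemma fil_impl i (Q : Prop) A : (Q -> Fil i A) -> Fil i [set w | Q -> A w].
Proof.
have [q FA|nq _] := pselect Q.
  rewrite (_ : [set _ | _] = A); first exact: FA.
  by apply/seteqP; split=> w /=; [apply | move=> ? _].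
rewrite (_ : [set _ | _] = [set _ | True]); first exact: fil_prop.
by apply/seteqP; split=> w //= _ /nq.
Qed.

Lemma fil_conj i (Q : Prop) A : (Q -> Fil i A) -> Fil i [set w | Q /\ A w].
Proof.
have [q FA|nq _] := pselect Q.
  by apply: fil_and; [exact: fil_prop | exact: FA].
rewrite (_ : [set _ | _] = [set _ | False]); first exact: fil_prop.
by apply/seteqP; split=> w // [].
Qed.

Definition adapted i (f : T -> R) : Prop :=
  forall B, measurable B -> Fil i (f @^-1` B).

Lemma adapted_le i j f : (i <= j)%N -> adapted i f -> adapted j f.
Proof. by move=> ij Ff B mB; apply: natural_filtration_le ij _; exact: Ff. Qed.

Lemma adapted_cst i c : adapted i (fun=> c).
Proof. by move=> B _; exact: (@fil_prop i (B c)). Qed.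

Lemma adapted_X i k : (1 <= k <= i)%N -> adapted i (X k).
Proof.
move=> ki B mB; apply: sub_sigma_algebra; exists k => //=.
by exists B; rewrite ?setTI.
Qed.

Lemma adapted_comp i f g : measurable_fun setT g -> adapted i f -> adapted i (g \o f).
Proof.
move=> mg Ff B mB; rewrite comp_preimage; apply: Ff.
by rewrite -[X in measurable X]setTI; exact: mg.
Qed.

Lemma adapted_if i (b : T -> bool) f g :
  Fil i [set w | b w] -> adapted i f -> adapted i g ->
  adapted i (fun w => if b w then f w else g w).
Proof.
move=> Fb Ff Fg B mB.
rewrite (_ : _ @^-1` _ =
  ([set w | b w] `&` f @^-1` B) `|` (~` [set w | b w] `&` g @^-1` B)).
  apply: (@measurableU _ (FilType i)); apply: (@measurableI _ (FilType i)) => //.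
  - exact: Ff.
  - exact: (@measurableC _ (FilType i)).
  - exact: Fg.
apply/seteqP; split=> w /=.
  by case: ifPn => bw fB; [left | right; split=> //; exact/negP].
by case=> -[bw fB]; [rewrite bw | move/negP/negbTE: bw => ->].
Qed.

(** The sigma-field of the past is itself taken as a measurable structure on
    the sample space, for which f and g are measurable functions. *)
Lemma adapted_pair i f g (r : R -> R -> bool) : adapted i f -> adapted i g ->
  measurable_fun [set: R * R] (fun z : R * R => r z.1 z.2) ->
  Fil i [set w | r (f w) (g w)].
Proof.
move=> Ff Fg mr.
have mf : @measurable_fun _ _ (FilType i) R setT f.
  by move=> _ B mB; rewrite setTI; exact: Ff.
have mg : @measurable_fun _ _ (FilType i) R setT g.
  by move=> _ B mB; rewrite setTI; exact: Fg.
have := measurableT_comp mr (measurable_fun_pair mf mg).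
move=> /(_ (@measurableT _ (FilType i)) [set true]).
by rewrite setTI; apply.
Qed.

(** Time i is selected iff some stopping time is at most i but not at most
    i - 1. *)
Lemma fil_selected n tau i : feasible X n tau -> Fil i [set w | selected n tau i w].
Proof.
move=> ft.
have [i0|i1] := leqP i 0.
  rewrite (_ : [set _ | _] = [set _ | False]); first exact: fil_prop.
  apply/seteqP; split=> // w /= /(selected_horizon ft).
  by move: i0; rewrite leqn0 => /eqP ->.
rewrite (_ : [set _ | _] = [set w | exists j, (1 <= j <= n)%N /\
    (time_le (tau j w) i /\ ~ time_le (tau j w) i.-1)]).
  apply: fil_exists => j; apply: fil_conj => jn.
  have [st _] := ft.1 j jn.
  apply: fil_and; first exact: st.
  by apply: fil_not; apply: natural_filtration_le (leq_pred i) _; exact: st.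
apply/seteqP; split=> w /=.
  move=> /selectedP[j jn tji]; exists j; split => //; rewrite tji /=.
  by rewrite leqnn; split=> //; apply/negP; rewrite -ltnNge prednK.
move=> [j [jn]]; case tj : (tau j w) => [k|] /= []; last by [].
move=> ki ik; apply/selectedP; exists j => //; rewrite tj; congr Some.
apply/eqP; rewrite eqn_leq ki /=; rewrite -[i]prednK // ltnNge; exact/negP.
Qed.

End FiltrationSets.

Section PolicyFeasibility.
Context d (T : measurableType d) (R : realType).
Variables (X : nat -> T -> R) (acc : nat -> R -> R -> bool) (n : nat).
Hypothesis macc : forall k,
  measurable_fun [set: R * R] (fun z : R * R => acc k z.1 z.2).
Hypothesis acc_le : forall k s x, acc k s x -> s <= x.
Local Notation Fil := (natural_filtration X).

Lemma adapted_last_value l i : (l <= i)%N -> adapted X i (last_value X l).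
Proof.
case: l => [|l] li; first exact: adapted_cst.
exact: adapted_X.
Qed.

Lemma fil_accepts k l i : (l < i)%N ->
  Fil i [set w | acc k (last_value X l w) (X i w)].
Proof.
move=> li; apply: (adapted_pair (r := acc k)) => //.
  exact: adapted_last_value (ltnW li).
by apply: adapted_X; rewrite leqnn (leq_ltn_trans _ li).
Qed.

(** The event tau_{j+1} = k is a countable union over the value l of tau_j of
    an acceptance at k with rejections strictly between l and k. *)
Lemma fil_adaptive_policy j k :
  Fil k [set w | adaptive_policy X acc n j w = Some k].
Proof.
elim: j k => [|j ih] k; first exact: (@fil_prop _ _ _ X k (Some 0%N = Some k)).
rewrite (_ : [set _ | _] = [set w | exists l, (l < k <= n)%N /\
  (adaptive_policy X acc n j w = Some l /\
   (acc (n - k + 1) (last_value X l w) (X k w) /\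
    forall i, (l < i < k)%N ->
      ~ acc (n - i + 1) (last_value X l w) (X i w)))]).
  apply: fil_exists => l; apply: fil_conj => /andP[lk kn].
  apply: fil_and; first exact: natural_filtration_le (ltnW lk) (ih l).
  apply: fil_and; first exact: fil_accepts.
  apply: fil_forall => i; apply: fil_impl => /andP[li ik].
  apply: (fil_not (A := [set w | acc (n - i + 1) (last_value X l w) (X i w)])).
  by apply: natural_filtration_le (ltnW ik) _; exact: fil_accepts.
apply/seteqP; split=> w /=.
  move=> /adaptive_policyS[l [tl lk al nal]]; exists l; do 3 split=> //.
  by move=> i ik; exact/negP/nal.
move=> [l [lk [tl [al nal]]]]; apply/adaptive_policyS; exists l; split=> //.
by move=> i ik; exact/negP/nal.
Qed.

(** Monotonicity of the selected values comes from the acceptance rule, which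
    compares with the last selected value; rank j >= 1 guarantees that this value is
    that of an observation and not the initial 0. *)
Lemma adaptive_policy_feasible : feasible X n (adaptive_policy X acc n).
Proof.
split=> [[//|j] jn|j w /andP[j1 jn]].
  split.
    move=> i; rewrite (_ : [set _ | _] = [set w | exists k, (k <= i)%N /\
        adaptive_policy X acc n j.+1 w = Some k]).
      apply: fil_exists => k; apply: fil_conj => ki.
      by apply: (natural_filtration_le ki); exact: fil_adaptive_policy.
    apply/seteqP; split=> w; rewrite /mkset;
      case: (adaptive_policy X acc n j.+1 w) => [k|] //=.
    - by move=> ki; exists k.
    - by move=> [k' [ki [->]]].
    - by move=> [k' []].
  move=> w; case t : (adaptive_policy X acc n j.+1 w) => [k|]; last by left.
  right; have /adaptive_policyS[l [_ /andP[lk kn] _ _]] := t.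
  by rewrite /= kn (leq_ltn_trans _ lk).
split.
- case tj : (adaptive_policy X acc n j w) => [l|] // _.
  case tj' : (adaptive_policy X acc n j.+1 w) => [k|] //.
  have /adaptive_policyS[l' [+ /andP[lk _] _ _]] := tj'.
  by rewrite tj => -[->].
- by rewrite /= => ->.
- move=> l k tj /adaptive_policyS[l' []]; rewrite tj => -[<-] _ /acc_le + _.
  case: l tj => [|l] //=; case: j j1 jn => // j _ _ tj.
  by have /adaptive_policyS[l [_ /andP[]]] := tj.
Qed.

Lemma adapted_last_selected i : adapted X i
  (fun w => last_value X (last_index X acc n i w) w).
Proof.
elim: i => [|i ih]; first exact: adapted_cst.
rewrite (_ : (fun w => _) = fun w =>
  if acc (n - i.+1 + 1) (last_value X (last_index X acc n i w) w) (X i.+1 w)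
  then X i.+1 w else last_value X (last_index X acc n i w) w).
  apply: adapted_if.
  - apply: (adapted_pair (r := acc (n - i.+1 + 1))
       (f := fun w => last_value X (last_index X acc n i w) w)) => //.
      exact: adapted_le (leqnSn i) ih.
    by apply: adapted_X; rewrite leqnn.
  - by apply: adapted_X; rewrite leqnn.
  - exact: adapted_le (leqnSn i) ih.
by apply/funext => w /=; case: ifP.
Qed.

End PolicyFeasibility.

(** * Bounds on the mean number of selections *)

Section Bounds.
Context d (T : measurableType d) (R : realType) (P : probability T R).
Variables (X : nat -> {RV P >-> R}) (F : R -> R).
Hypothesis X_indep : mutually_independent P [set i | (1 <= i)%N] (fun i => X i).
Hypothesis X_cdf : forall i x, (1 <= i)%N -> cdf (X i) x = (F x)%:E.
Hypothesis F_cont : continuous F.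
Variable n : nat.
Local Notation X' := (fun i => X i : T -> R).

Lemma mean_next_le i (S : T -> R) (g : R * R -> \bar R) (c : R) :
  adapted X' i S -> measurable_fun setT g -> (forall z, 0 <= g z)%E ->
  (forall w, \int[P]_v g (S w, X i.+1 v) <= c%:E)%E ->
  (\int[P]_w g (S w, X i.+1 w) <= c%:E)%E.
Proof.
move=> FS mg g0 gc.
have mS : measurable_fun setT S.
  move=> _ B mB; rewrite setTI; apply: (natural_filtration_measurable (X := X)).
  exact: FS.
pose Sm : {RV P >-> R} := mfun_Sub (mem_set mS).
apply: (@integral_independent_le _ _ _ P _ _ _ _ Sm (X i.+1)) => //.
move=> A B mA mB; apply: (natural_filtration_indep_next X_indep) => //.
exact: FS.
Qed.

Let X1_cdf x : cdf (X 1%N) x = (F x)%:E := @X_cdf 1%N x isT.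
Let F01 x : 0 <= F x <= 1 := cdf_fin_bounds X1_cdf x.
Let F_le : {homo F : x y / x <= y} := cdf_fin_le X1_cdf.
Let mF : measurable_fun setT F := measurable_cdf_fin F_cont.

Lemma measurable_selected tau i : feasible X' n tau ->
  measurable_fun setT (fun w => (selected n tau i w)%:R : R).
Proof.
move=> ft; rewrite (_ : (fun w => _) = \1_[set w | selected n tau i w]).
  apply: measurable_indic.
  by apply: (natural_filtration_measurable (X := X)); exact: fil_selected.
by apply/funext => w; rewrite indicE mem_setE.
Qed.

Lemma num_selected_sum tau w : feasible X' n tau ->
  (num_selected n tau w)%:R = \sum_(i < n) (selected n tau i.+1 w)%:R :> R.
Proof. by move=> ft; rewrite (num_selectedE w ft) natr_sum. Qed.

Lemma measurable_num_selected tau : feasible X' n tau ->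
  measurable_fun setT (fun w => (num_selected n tau w)%:R : R).
Proof.
move=> ft; under eq_fun do rewrite num_selected_sum //.
by apply: measurable_sum => i; exact: measurable_selected.
Qed.

Section UpperBound.
Variable tau : nat -> T -> option nat.
Hypothesis tau_feasible : feasible X' n tau.

(** On the F-scale the starting level is 0 even if X takes negative values on a
    null set, which keeps the comparison with later selections pointwise. *)
Fixpoint level i w : R :=
  if i is i'.+1 then if selected n tau i w then F (X i w) else level i' w else 0.

Lemma level_bounds i w : 0 <= level i w <= 1.
Proof. by elim: i => [|i ih] /=; [rewrite lexx ler01 | case: ifP]. Qed.

Lemma level_le i l w : (i < l)%N -> selected n tau l w -> level i w <= F (X l w).
Proof.
move=> il sl; elim: i il => [|i ih] il /=; first by case/andP: (F01 (X l w)).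
case: ifPn => si; last by apply: ih; exact: ltnW.
exact/F_le/(selected_le tau_feasible il si sl).
Qed.

Lemma adapted_level i : adapted X' i (level i).
Proof.
elim: i => [|i ih]; first exact: adapted_cst.
apply: (adapted_if (b := selected n tau i.+1) (f := F \o X i.+1) (g := level i)).
- exact: fil_selected.
- by apply: adapted_comp => //; apply: adapted_X; rewrite leqnn.
- exact: adapted_le (leqnSn i) ih.
Qed.

(** Each selection earns lam, which the rise of the level and the shortfall
    together cover. *)
Lemma selections_le_level lam k w : 0 <= lam ->
  lam * \sum_(i < k) (selected n tau i.+1 w)%:R <=
  level k w + \sum_(i < k) shortfall lam (level i w) (F (X i.+1 w)).
Proof.
move=> lam0; elim: k => [|k ih]; first by rewrite !big_ord0 mulr0 addr0.
rewrite !big_ord_recr /= mulrDr.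
have := shortfall_ge0 lam (level k w) (F (X k.+1 w)).
have [sk|_] := boolP (selected n tau k.+1 w); last by rewrite mulr0n mulr0; lra.
have lk := level_le (ltnSn k) sk.
have : lam - (F (X k.+1 w) - level k w)
    <= shortfall lam (level k w) (F (X k.+1 w)).
  by rewrite /shortfall lk le_max lexx orbT.
by rewrite mulr1n; lra.
Qed.

Lemma measurable_shortfall lam :
  measurable_fun [set: R * R] (fun z : R * R => (shortfall lam z.1 (F z.2))%:E).
Proof.
have mF2 : measurable_fun [set: R * R] (fun z : R * R => F z.2).
  exact: measurableT_comp.
apply/measurable_EFinP; apply: measurable_fun_ifT => //.
  exact: measurable_fun_ler.
apply: measurable_maxr => //; apply: measurable_funB => //.
exact: measurable_funB.
Qed.

(** The price lam = 2 / sqrt (2n) minimises (1 + n lam^2 / 2) / lam. *)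
Lemma mean_selected_le_sqrt : (1 <= n)%N ->
  (mean_selected P n tau <= (Num.sqrt (2 * n%:R) : R)%:E)%E.
Proof.
move=> n1; rewrite /mean_selected unlock.
set s : R := Num.sqrt (2 * n%:R).
have n0 : 0 < n%:R :> R by rewrite ltr0n.
have s0 : 0 < s by rewrite sqrtr_gt0 mulr_gt0.
have s2 : s ^+ 2 = 2 * n%:R by rewrite sqr_sqrtr // mulr_ge0 // ltW.
pose lam := 2 / s.
have lam0 : 0 < lam by rewrite divr_gt0.
have mN := measurable_num_selected tau_feasible.
have mlev i : measurable_fun setT (level i).
  move=> _ B mB; rewrite setTI; apply: (natural_filtration_measurable (X := X)).
  exact: adapted_level.
have msh i : measurable_fun setT
    (fun w => (shortfall lam (level i w) (F (X i.+1 w)))%:E).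
  apply: (measurableT_comp (measurable_shortfall lam)
    (g := fun w => (level i w, X i.+1 w))).
  exact: measurable_fun_pair.
have sh0 i w : (0 <= (shortfall lam (level i w) (F (X i.+1 w)))%:E)%E.
  by rewrite lee_fin shortfall_ge0.
have Esh i : (\int[P]_w (shortfall lam (level i w) (F (X i.+1 w)))%:E
    <= (lam ^+ 2 / 2)%:E)%E.
  apply: (@mean_next_le i (level i) (fun z => (shortfall lam z.1 (F z.2))%:E)).
  - exact: adapted_level.
  - exact: measurable_shortfall.
  - by move=> z; rewrite lee_fin shortfall_ge0.
  - move=> w /=; apply: mean_shortfall_le; rewrite ?(ltW lam0) ?level_bounds //.
    by move=> x; exact: X_cdf.
have : (\int[P]_w (lam%:E * (num_selected n tau w)%:R%:E) <=
  \int[P]_w (cst 1%:E w +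
    \sum_(i < n) (shortfall lam (level i w) (F (X i.+1 w)))%:E))%E.
  apply: ge0_le_integral => //.
  - by move=> w _; rewrite -EFinM lee_fin mulr_ge0 // ltW.
  - by apply: measurable_funeM; exact/measurable_EFinP.
  - by apply: emeasurable_funD => //; exact: emeasurable_sum.
  - move=> w _; rewrite -EFinM sumEFin -EFinD lee_fin num_selected_sum //.
    apply: (le_trans (selections_le_level n w (ltW lam0))).
    by rewrite lerD2r; case/andP: (level_bounds n w).
have mEN : measurable_fun setT (fun w => ((num_selected n tau w)%:R : R)%:E).
  exact/measurable_EFinP.
rewrite ge0_integralZl ?lee_fin ?(ltW lam0) //.
rewrite ge0_integralD //; last 2 first.
- by move=> w _; exact: sume_ge0.
- exact: emeasurable_sum.
rewrite integral_cst //= probability_setT mule1 ge0_integral_sum //= => le1.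
rewrite -(lee_pmul2l (x := lam%:E)) ?lte_fin // -EFinM.
apply: (le_trans le1).
apply: (@le_trans _ _ (1%:E + \sum_(i < n) (lam ^+ 2 / 2)%:E)%E).
  by rewrite leeD2l //; apply: lee_sum.
rewrite sumEFin -EFinD lee_fin sumr_const card_ord -[_ *+ n]mulr_natr.
have -> : lam * s = 2 by rewrite /lam divfK // gt_eqF.
have -> : lam ^+ 2 / 2 * n%:R = 1.
  by rewrite /lam expr_div_n s2; field; rewrite gt_eqF.
by lra.
Qed.

End UpperBound.

Section LowerBound.
Local Notation pihat := (pi_hat F X' n).

Lemma pi_hat_feasible : feasible X' n pihat.
Proof.
apply: adaptive_policy_feasible; last by move=> k s x /andP[].
by move=> k; exact: measurable_accept_hat.
Qed.

Let state i w : R := last_value X' (last_index X' (accept_hat F) n i w) w.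
Let picks i w : bool := accept_hat F (n - i) (state i w) (X i.+1 w).

Lemma picks_selected i w : (i < n)%N -> picks i w -> selected n pihat i.+1 w.
Proof.
move=> ltin pi; apply: accepts_selected => //.
by rewrite addn1 subnSK.
Qed.

(** Adding the selections back to the regrets leaves the telescoping sum of
    predicted values, plus 3 per step. *)
Lemma regret_telescope k w : (k <= n)%N ->
  \sum_(i < k) (regret F (n - i.+1) (state i w) (X i.+1 w) + (picks i w)%:R) =
  3 * k%:R + value_bound n (F 0) - value_bound (n - k) (F (state k w)).
Proof.
elim: k => [|k ih] kn; first by rewrite big_ord0 subn0 mulr0 add0r subrr.
rewrite big_ord_recr /= ih ?(ltnW kn) //.
have stateS : state k.+1 w = if picks k w then X k.+1 w else state k w.
  by rewrite /state /= addn1 subnSK // -/(state k w) -/(picks k w); case: ifP.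
have nk : (n - k)%N = (n - k.+1).+1 by rewrite subnSK.
rewrite stateS /regret -nk -/(picks k w) -natr1.
by case: ifP => _; rewrite ?mulr0n ?mulr1n; ring.
Qed.

(** The total in [regret_telescope] is deterministic at time n because the
    value with no observation to come is 0, and the regrets have mean at most 3
    each. *)
Lemma mean_pi_hat_ge : ((value_bound n (F 0))%:E <= mean_selected P n pihat)%E.
Proof.
rewrite /mean_selected unlock.
have macc k : measurable_fun [set: R * R]
    (fun z : R * R => accept_hat F k z.1 z.2).
  exact: measurable_accept_hat.
have Fst i : adapted X' i (state i) by exact: adapted_last_selected.
have mst i : measurable_fun setT (state i).
  move=> _ B mB; rewrite setTI; apply: (natural_filtration_measurable (X := X)).
  exact: Fst.
have reg0 k s x : 0 <= regret F k s x.
  exact: (regret_ge0 X1_cdf).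
have mSX i : measurable_fun setT (fun w => (state i w, X i.+1 w)).
  exact: measurable_fun_pair.
have mreg i : measurable_fun setT
    (fun w => (regret F (n - i.+1) (state i w) (X i.+1 w))%:E).
  exact: (measurableT_comp (measurable_regret F_cont (n - i.+1)%N) (mSX i)).
have mpick i : measurable_fun setT (fun w => (picks i w)%:R%:E : \bar R).
  apply/measurable_EFinP.
  apply: (measurableT_comp (f := fun b : bool => b%:R : R)) => //.
  exact: (measurableT_comp (macc (n - i)%N) (mSX i)).
have Ereg i : (\int[P]_w (regret F (n - i.+1) (state i w) (X i.+1 w))%:E <= 3%:E)%E.
  apply: (@mean_next_le i (state i) (fun z => (regret F (n - i.+1) z.1 z.2)%:E)).
  - exact: Fst.
  - exact: measurable_regret.
  - by move=> z; rewrite lee_fin.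
  - by move=> w; apply: mean_regret_le => // x; exact: X_cdf.
have tele w : (\sum_(i < n) (regret F (n - i.+1) (state i w) (X i.+1 w))%:E +
    \sum_(i < n) (picks i w)%:R%:E = (3 * n%:R + value_bound n (F 0))%:E)%E.
  rewrite !sumEFin -EFinD -big_split /= regret_telescope // subnn value_bound0.
  by rewrite subr0.
have Sreg0 w : (0 <= \sum_(i < n) (regret F (n - i.+1) (state i w) (X i.+1 w))%:E)%E.
  by apply: sume_ge0 => i _; rewrite lee_fin.
have Spick0 w : (0 <= \sum_(i < n) (picks i w)%:R%:E :> \bar R)%E.
  by apply: sume_ge0 => i _; rewrite lee_fin.
have : ((3 * n%:R + value_bound n (F 0))%:E =
  \int[P]_w (\sum_(i < n) (regret F (n - i.+1) (state i w) (X i.+1 w))%:E) +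
  \int[P]_w (\sum_(i < n) (picks i w)%:R%:E))%E.
  rewrite -ge0_integralD //; [|exact: emeasurable_sum..].
  under eq_integral do rewrite tele.
  by rewrite integral_cst //= probability_setT mule1.
move=> e.
have le_picks : (\int[P]_w (\sum_(i < n) (picks i w)%:R%:E)
    <= \int[P]_w (num_selected n pihat w)%:R%:E)%E.
  apply: ge0_le_integral => //.
  - exact: emeasurable_sum.
  - exact/measurable_EFinP/measurable_num_selected/pi_hat_feasible.
  - move=> w _; rewrite sumEFin lee_fin (num_selected_sum w pi_hat_feasible).
    apply: ler_sum => i _; rewrite ler_nat.
    by have := @picks_selected i w (ltn_ord i); case: (picks i w) => // ->.
apply: le_trans le_picks.
have le3 : (\int[P]_w (\sum_(i < n) (regret F (n - i.+1) (state i w) (X i.+1 w))%:E)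
   <= (3 * n%:R)%:E)%E.
  rewrite ge0_integral_sum //; last by move=> i w _; rewrite lee_fin.
  apply: (@le_trans _ _ (\sum_(i < n) 3%:E)%E); first exact: lee_sum.
  by rewrite sumEFin lee_fin sumr_const card_ord mulr_natr.
suff : ((3 * n%:R)%:E + (value_bound n (F 0))%:E <=
  (3 * n%:R)%:E + \int[P]_w (\sum_(i < n) (picks i w)%:R%:E))%E.
  by rewrite leeD2lE.
by rewrite -EFinD e leeD2r.
Qed.

End LowerBound.
End Bounds.

(** Otherwise F would take the value F(0) / 2 > 0 at some x < 0, although
    Y <= x is a null event. *)
Lemma cdf_fin0 d (T : measurableType d) (R : realType) (P : probability T R)
    (Y : {RV P >-> R}) (F : R -> R) :
  (forall x, cdf Y x = (F x)%:E) -> continuous F ->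
  {ae P, forall w, 0 <= Y w} -> F 0 = 0.
Proof.
move=> Y_cdf F_cont Y_ge0.
have /andP[F0 F1] := cdf_fin_bounds Y_cdf 0.
apply/eqP; rewrite eq_le F0 andbT leNgt; apply/negP => F0_gt0.
have [x xE] : exists x, F x = F 0 / 2.
  by apply: (cdf_fin_onto Y_cdf F_cont); lra.
have x0 : x < 0.
  by rewrite ltNge; apply/negP => /(cdf_fin_le Y_cdf); lra.
have : (F x)%:E = 0%:E.
  rewrite -Y_cdf; change (P (Y @^-1` `]-oo, x]) = 0%:E).
  apply: measure_negligible; first exact: measurable_funPTI.
  apply: (negligibleS _ Y_ge0) => w /=; rewrite in_itv /= => Yx Y0.
  by have := le_lt_trans Yx x0; rewrite ltNge Y0.
by move=> [] Fx0; lra.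
Qed.

Theorem theorem1 (d : measure_display) (T : measurableType d) (R : realType)
    (P : probability T R) (X : nat -> {RV P >-> R}) (F : R -> R)
    (X_indep : mutually_independent P [set i | (1 <= i)%N] (fun i => X i))
    (X_ge0 : forall i, (1 <= i)%N -> {ae P, forall w, 0 <= X i w})
    (X_cdf : forall i x, (1 <= i)%N -> cdf (X i) x = (F x)%:E)
    (F_cont : continuous F)
    (n : nat) (n_ge1 : (1 <= n)%N) :
  let X' : nat -> T -> R := fun i => X i in
  let pihat := pi_hat F X' n in
  let lower : R := Num.sqrt (2 * n%:R) - 2 * (ln n%:R + 1) in
  let upper : R := Num.sqrt (2 * n%:R) in
  [/\ feasible X' n pihat,
      (lower%:E <= mean_selected P n pihat)%E,
      (mean_selected P n pihat <= optimal_value P X' n <= upper%:E)%E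
    & forall pistar, optimal P X' n pistar ->
        (mean_selected P n pihat <= mean_selected P n pistar <= upper%:E)%E].
Proof.
move=> X' pihat lower upper.
have X1_cdf x : cdf (X 1%N) x = (F x)%:E := @X_cdf 1%N x isT.
have pihat_feasible : feasible X' n pihat by exact: pi_hat_feasible.
have opt : (mean_selected P n pihat <= optimal_value P X' n <= upper%:E)%E.
  apply/andP; split; first by apply: ereal_sup_ubound; exists pihat.
  apply: ge_ereal_sup => _ [tau tau_feasible <-].
  exact: (mean_selected_le_sqrt X_indep X_cdf F_cont tau_feasible).
split=> //; last by move=> pistar [_ ->].
apply: le_trans (mean_pi_hat_ge X_indep X_cdf F_cont n).
have F0 : F 0 = 0 by exact: cdf_fin0 X1_cdf F_cont (X_ge0 _ (leqnn 1)).
rewrite lee_fin /value_bound F0 subr0 mulr1 lerD2l lerN2 ler_wpM2l //.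
exact: harmonic_sum_le_ln.
Qed.
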